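(* Consider the online hiring problem with costs drawn i.i.d. from the uniform distribution $U[0,1]$ (the algorithm may know the distribution and $n$). Every online algorithm has competitive ratio at least $2$, i.e., $\limsup_{n\to\infty}\mathbf{E}[\textsc{Alg}_n]/\mathbf{E}[\textsc{Opt}_n]\ge 2$.
   Context: Online hiring problem: there are $n$ time steps; in time step $i$ applicant $i$ arrives and its cost $x_i$ is revealed, where $x_1,\dots,x_n$ are drawn independently from a distribution $X$. Immediately and irrevocably at time $i$, based only on $x_1,\dots,x_i$ and earlier decisions, the algorithm chooses a nonnegative integer duration $t_i$; applicant $i$ is then under contract during time steps $i,\dots,i+t_i-1$. At every time step $s\in\{1,\dots,n\}$ at least one applicant must be under contract. The cost is $\sum_i t_ix_i$; $\textsc{Alg}_n$ denotes the cost of the online algorithm and $\textsc{Opt}_n$ the minimum cost of a feasible solution knowing all $x_1,\dots,x_n$ in advance. The competitive ratio is $\limsup_{n}\mathbf{E}[\textsc{Alg}_n]/\mathbf{E}[\textsc{Opt}_n]$. *)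

(* Defs.v *)
From HB Require Import structures.
From mathcomp Require Import all_boot all_order all_algebra.
From mathcomp Require Import finmap.
From mathcomp Require Import all_classical all_reals all_analysis.

Set Implicit Arguments.
Unset Strict Implicit.
Unset Printing Implicit Defensive.
Import Order.TTheory GRing.Theory Num.Theory.

Local Open Scope classical_set_scope.
Local Open Scope ring_scope.

(* Time steps and applicants are numbered from 0; with horizon n only the
   indices i < n matter. *)

Definition under_contract (t : nat -> nat) (i s : nat) : bool :=
  (i <= s < i + t i)%N.

Definition feasible (n : nat) (t : nat -> nat) : Prop :=
  forall s, (s < n)%N -> exists2 i, (i < n)%N & under_contract t i s.

Definition cost (R : realType) (n : nat) (x : nat -> R) (t : nat -> nat) : R :=
  \sum_(i < n) (t i)%:R * x i.

(* For nonnegative costs this infimum is a minimum: it is attained by hiring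
   each prefix minimum until the next one arrives. *)
Definition opt (R : realType) (n : nat) (x : nat -> R) : R :=
  inf [set cost n x t | t in feasible n].

(* [A n u xs h] is the duration chosen for the current applicant at horizon n,
   where xs lists the costs revealed so far (including the current one), h the
   earlier decisions, and u is the private random seed of the algorithm; a
   deterministic algorithm is one that ignores u (e.g. S = unit). *)
Definition online_rule (R S : Type) := nat -> S -> seq R -> seq nat -> nat.

Fixpoint history (R S : Type) (A : online_rule R S) (n : nat) (u : S)
    (x : nat -> R) (i : nat) : seq nat :=
  if i is j.+1 then
    let h := history A n u x j in rcons h (A n u (mkseq x j.+1) h)
  else [::].

Definition decision (R S : Type) (A : online_rule R S) (n : nat) (u : S)
    (x : nat -> R) (i : nat) : nat :=
  A n u (mkseq x i.+1) (history A n u x i).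

Definition alg (R : realType) (S : Type) (A : online_rule R S) (n : nat)
    (u : S) (x : nat -> R) : R :=
  cost n x (decision A n u x).

Definition measurable_rule (R : realType) (dS : measure_display)
    (S : measurableType dS) (A : online_rule R S) : Prop :=
  forall (n k : nat) (h : seq nat),
    measurable_fun [set: S * k.+1.-tuple R]
      (fun p : S * k.+1.-tuple R => A n p.1 (tval p.2) h).

Definition feasible_rule (R : realType) (S : Type) (A : online_rule R S) :=
  forall (n : nat) (u : S) (x : nat -> R),
    (forall i, (i < n)%N -> 0 <= x i <= 1) -> feasible n (decision A n u x).

Definition mutually_independent (R : realType) (d : measure_display)
    (T : measurableType d) (P : probability T R) (I : choiceType)
    (F : I -> set_system T) : Prop :=
  forall (J : {fset I}) (E : I -> set T),
    (forall i, i \in J -> F i (E i)) ->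
    P (\bigcap_(i in [set` J]) E i) = (\prod_(i <- J) P (E i))%E.

(* The sigma-algebras generated by the seed and by each of the costs. *)
Definition seed_cost_sigma (R : realType) (d dS : measure_display)
    (T : measurableType d) (S : measurableType dS)
    (U : T -> S) (X : nat -> T -> R) (o : option nat) : set_system T :=
  if o is Some i then preimage_set_system setT (X i) measurable
  else preimage_set_system setT U measurable.

(* Main.v *)
(* Charge every time step [s] to the first applicant whose contract covers it.
   A contract of length [t] is charged at most [t] times, so the algorithm pays
   at least the sum over [s < n] of the cost of the applicant charged for [s].
   The index of that applicant is a stopping time bounded by [s], hence the
   expected charge is at least the value [w (s + 1)] of optimal stopping for the
   minimum of [s + 1] uniform costs, where [w 0 = 1] and
   [w (j + 1) = E min(x, w j) = w j - (w j)^2 / 2], so [w j] is asymptotically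
   [2 / j].  The optimum pays for step [s] the minimum of the first [s + 1]
   costs, with expectation [1 / (s + 2)].  Both sums diverge like a harmonic
   series and their ratio tends to 2. *)

Require Import Defs.
From HB Require Import structures.
From mathcomp Require Import all_boot all_order all_algebra.
From mathcomp Require Import finmap.
From mathcomp Require Import all_classical all_reals all_analysis.
From mathcomp Require Import measurable_realfun ring lra zify.

Set Implicit Arguments.
Unset Strict Implicit.
Unset Printing Implicit Defensive.
Import Order.TTheory GRing.Theory Num.Theory.
Import numFieldNormedType.Exports HBNNSimple.
Local Open Scope classical_set_scope.
Local Open Scope ring_scope.

(** * Integral comparison and the tail formula for expectations *)

(* No measurability is assumed of [f] and [g]: the offline optimum is only
   known to be measurable almost everywhere. *)
Lemma le_integral_off_null (d : measure_display) (T : measurableType d)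
    (R : realType) (mu : {measure set T -> \bar R}) (N : set T)
    (f g : T -> \bar R) :
  measurable N -> mu N = 0%E -> (forall x, ~ N x -> (f x <= g x)%E) ->
  (\int[mu]_x f x <= \int[mu]_x g x)%E.
Proof.
move=> mN N0 fg.
have mNC : measurable (~` N) by exact: measurableC.
have H (f' g' : T -> \bar R) : (forall x, 0 <= g' x)%E ->
    (forall x, ~ N x -> (f' x <= g' x)%E) ->
    (ereal_sup [set sintegral mu h |
      h in [set h : {nnsfun T >-> R} | forall x, ((h x)%:E <= f' x)%E]]
     <= ereal_sup [set sintegral mu h |
      h in [set h : {nnsfun T >-> R} | forall x, ((h x)%:E <= g' x)%E]])%E.
  move=> g0 fg'; apply: ge_ereal_sup => _ [h /= hf <-].
  (* Cutting [h] down to the complement of [N] keeps its integral and puts it below [g']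
     everywhere. *)
  apply: ereal_sup_ubound => /=; exists (proj_nnsfun h mNC) => /=.
    move=> x; rewrite -[h x * _]/(proj_nnsfun h mNC x) -mrestrict patchE.
    by case: ifPn => // /set_mem Nx; exact: le_trans (hf x) (fg' x Nx).
  rewrite -mrestrict -integral_nnsfun//.
  rewrite -[in RHS](patch_setT (fun=> 0) (h : T -> R)).
  rewrite -(@integral_nnsfun _ _ _ mu setT)//.
  rewrite [RHS](@ge0_negligible_integral _ _ _ mu _ N)//.
  - by rewrite setTD.
  - exact/measurable_EFinP.
  - by move=> x _; rewrite lee_fin.
rewrite /integral !patch_setT; apply: leeB; apply: H => x.
- exact: funepos_ge0.
- by move=> /fg fgx; rewrite !funeposE ge_max !le_max fgx lexx orbT.
- exact: funeneg_ge0.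
- by move=> /fg fgx; rewrite !funenegE ge_max !le_max leeN2 fgx lexx orbT.
Qed.

Lemma integral_onemX (R : realType) (m : nat) (c : R) : 0 < c ->
  (\int[@lebesgue_measure R]_(t in `[0%R, c]) ((1 - t) ^+ m)%:E =
   ((1 - (1 - c) ^+ m.+1) / m.+1%:R)%:E)%E.
Proof.
move=> c0.
pose F (y : R) := (1 - y) ^+ m.+1 * - (m.+1%:R)^-1.
have cF (t : R) : {for t, continuous F}.
  by apply: cvgMl; exact: continuous_onemXn.
rewrite (@continuous_FTC2 _ _ F)//.
- rewrite /F subr0 expr1n -EFinB; congr EFin; ring.
- by apply: continuous_in_subspaceT => x _; exact: continuous_onemXn.
- split.
  + by move=> y _; apply: derivableM => //=; exact: onemXn_derivable.
  + by apply: cvg_at_right_filter; exact: cF.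
  + by apply: cvg_at_left_filter; exact: cF.
- move=> x _; rewrite derive1Mr//; last exact: onemXn_derivable.
  by rewrite derive_onemXn mulrN !mulNr opprK mulrAC divff// mul1r.
Qed.

(** Integrates the tail [P (Y > t)] over [t]; it vanishes from [c] on. The use with [q = c = 1] is
    for prefix minima, the one with [m = 1] for a cost truncated at [c] on an independent event of
    probability [q]. *)
Lemma expectation_tail_onemX (d : measure_display) (T : measurableType d)
    (R : realType) (P : probability T R) (Y : T -> R) (m : nat) (c q : R) :
  measurable_fun setT Y -> 0 < c <= 1 -> 0 <= q -> (forall w, 0 <= Y w <= c) ->
  (forall t, 0 <= t < c -> P [set w | t < Y w] = (q * (1 - t) ^+ m)%:E) ->
  (\int[P]_w (Y w)%:E = (q * ((1 - (1 - c) ^+ m.+1) / m.+1%:R))%:E)%E.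
Proof.
move=> mY /andP[c0 c1] q0 Yc HP.
have Y0 w : 0 <= Y w by case/andP: (Yc w).
pose Y' : {RV P >-> R} := mfun_Sub (mem_set mY : Y \in mfun).
have := @ge0_expectation_ccdf _ _ _ P Y' Y0; rewrite unlock => ->.
transitivity (\int[@lebesgue_measure R]_(t in `[0%R, c[)
    (q%:E * ((1 - t) ^+ m)%:E))%E.
  rewrite integral_mkcond [RHS]integral_mkcond; apply: eq_integral => t _.
  rewrite !patchE !mem_setE !in_itv/= andbT; have [t0|//] := leP 0 t.
  rewrite /= /ccdf /distribution /pushforward/=.
  have -> : Y' @^-1` `]t, +oo[ = [set w | t < Y w].
    by apply/seteqP; split => w /=; rewrite in_itv/= andbT.
  case: ifPn => tc; first by rewrite HP ?t0// EFinM.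
  rewrite (_ : [set w | _] = set0) ?measure0//; apply/seteqP; split => w //=.
  have /andP[_ Ywc] := Yc w.
  by move=> /lt_le_trans/(_ Ywc); rewrite (negbTE tc).
have mF : measurable_fun setT (fun t : R => ((1 - t) ^+ m)%:E : \bar R).
  apply/measurable_EFinP; apply: measurable_funX; exact: measurable_funB.
have mFc : measurable_fun `[0, c[ (fun t : R => ((1 - t) ^+ m)%:E : \bar R).
  exact: measurable_funTS.
rewrite ge0_integralZl//.
- rewrite integral_itv_bndo_bndc//.
  by rewrite integral_onemX// EFinM.
- move=> t/=; rewrite in_itv/= => /andP[t0 tc].
  by rewrite lee_fin exprn_ge0// subr_ge0 (le_trans (ltW tc)).
Qed.

(** * Independence of one cost from the seed and all other costs *)

Section Independence.
Context (R : realType) (d dS : measure_display).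
Context (T : measurableType d) (S : measurableType dS).

(** A pi-system generating the sigma-algebra of the seed and of all costs except the [i]-th, later
    ones included. *)
Definition other_cylinders (U : T -> S) (X : nat -> T -> R) (i : nat) :
    set_system T :=
  [set E | exists2 J : {fset option nat}, Some i \notin J &
    exists2 B : option nat -> set T,
      forall o, seed_cost_sigma U X o (B o) & E = \bigcap_(o in [set` J]) B o].

Lemma seed_cost_sigmaT (U : T -> S) (X : nat -> T -> R) (o : option nat) :
  seed_cost_sigma U X o setT.
Proof.
by case: o => [i|] /=; exists setT => //; rewrite preimage_setT setIT.
Qed.

Lemma seed_cost_sigmaI (U : T -> S) (X : nat -> T -> R) (o : option nat)
    (B C : set T) :
  seed_cost_sigma U X o B -> seed_cost_sigma U X o C ->
  seed_cost_sigma U X o (B `&` C).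
Proof.
by case: o => [i|] /= [B' mB <-] [C' mC <-]; exists (B' `&` C');
  rewrite ?setTI ?preimage_setI//; exact: measurableI.
Qed.

Lemma seed_cost_sigma_measurable (U : {mfun T >-> S})
    (X : nat -> {mfun T >-> R}) (o : option nat) (B : set T) :
  seed_cost_sigma U (fun i => X i) o B -> measurable B.
Proof.
by case: o => [i|] /= [B' mB <-]; exact: (measurable_funPT _ measurableT).
Qed.

Lemma other_cylinders_setI (U : T -> S) (X : nat -> T -> R) (i : nat) :
  setI_closed (other_cylinders U X i).
Proof.
move=> E F [J Ji [B sB ->]] [K Ki [C sC ->]].
exists (J `|` K)%fset; first by rewrite inE negb_or Ji.
(* Each family is padded with [setT] outside its own index set, so that both can be indexed by the
   union. *)
exists (fun o => (if o \in J then B o else setT) `&`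
                 (if o \in K then C o else setT)).
  move=> o; apply: seed_cost_sigmaI; case: ifP => // _;
  exact: seed_cost_sigmaT.
apply/seteqP; split => w /=.
  by move=> [HB HC] o _; split; case: ifPn => // oJ; [exact: HB|exact: HC].
move=> H; split => o /= oJ.
  by have [] := H o; rewrite /= ?inE ?oJ.
by have [] := H o; rewrite /= ?inE ?oJ ?orbT.
Qed.

(** Pi-lambda argument: the measurable events independent of [F] form a Dynkin system, and it
    contains the cylinders by mutual independence. *)
Lemma indep_other_costs (P : probability T R)
    (U : {mfun T >-> S}) (X : nat -> {RV P >-> R}) (i : nat) (E : set T)
    (B : set R) :
  mutually_independent P (seed_cost_sigma U (fun i => X i)) ->
  <<s other_cylinders U (fun i => X i) i >> E -> measurable B ->
  measurable E /\ P (E `&` X i @^-1` B) = (P E * P (X i @^-1` B))%E.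
Proof.
move=> hindep sE mB; set F := X i @^-1` B.
have mF : measurable F by rewrite -[F]setTI; exact: measurable_funPT.
suff : <<s other_cylinders U (fun i => X i) i >> `<=`
    [set E | measurable E /\ P (E `&` F) = (P E * P F)%E] by move=> /(_ _ sE).
rewrite -setI_closed_g_dynkin_g_sigma_algebra; last exact: other_cylinders_setI.
apply: smallest_sub.
- split.
  + by split => //; rewrite setTI probability_setT mul1e.
  + move=> A [mA HA]; split; first exact: measurableC.
    have : P F = (P (~` A `&` F) + P (A `&` F))%E.
      by rewrite -(setIC F A) -(setIC F) -setDE; exact: measureDI.
    rewrite HA.
    rewrite probability_setC//.
    have mAF : measurable (~` A `&` F).
      by apply: measurableI => //; exact: measurableC.
    rewrite -(fineK (fin_num_measure P _ mA)) -(fineK (fin_num_measure P _ mF)).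
    rewrite -(fineK (fin_num_measure P _ mAF)).
    rewrite -EFinM -EFinD -EFinB -EFinM => -[HF].
    by congr EFin; rewrite mulrBl mul1r; apply/eqP; rewrite eq_sym subr_eq -HF.
  + move=> A tA HA; have mA k : measurable (A k) by have [] := HA k.
    split; first exact: bigcupT_measurable.
    have fF : P F = (fine (P F))%:E by rewrite fineK// fin_num_measure.
    rewrite setI_bigcupl measure_semi_bigcup//; first last.
    + by apply: bigcupT_measurable => k; exact: measurableI.
    + exact: trivIset_setIr.
    + by move=> k; exact: measurableI.
    rewrite measure_semi_bigcup//; last exact: bigcupT_measurable.
    rewrite muleC [in RHS]fF -nneseriesZl//; apply: eq_eseriesr => k _.
    by have [_ HAk] := HA k; rewrite -fF muleC; exact: HAk.
- move=> A [J Ji [C sC ->]]; split.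
    apply: fin_bigcap_measurable => // o _.
    exact: seed_cost_sigma_measurable (sC o).
  (* [F] becomes the factor at the fresh index [Some i], so that mutual independence applies both to
     [J] and to [J] enlarged by [Some i]. *)
  pose C' o := if o == Some i then F else C o.
  have sC' o : seed_cost_sigma U (fun i => X i) o (C' o).
    by rewrite /C'; case: eqP => [->|//]; exists B => //; rewrite setTI.
  have C'i : C' (Some i) = F by rewrite /C' eqxx.
  have CC' o : o \in J -> C' o = C o.
    by rewrite /C'; case: eqP => // ->; rewrite (negbTE Ji).
  have -> : \bigcap_(o in [set` J]) C o `&` F =
      \bigcap_(o in [set` (Some i |` J)%fset]) C' o.
    apply/seteqP; split => w /=.
      move=> [HC HF] o /=; rewrite !inE => /orP[/eqP->|oJ].
        by rewrite C'i.
      by rewrite CC'//; exact: HC.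
    move=> H; split; last by rewrite -C'i; apply: H; rewrite /= !inE eqxx.
    by move=> o /= oJ; rewrite -CC'//; apply: H; rewrite /= !inE oJ orbT.
  rewrite !hindep// big_fsetU1//= muleC C'i; congr (_ * _)%E.
  by rewrite big_seq [RHS]big_seq; apply: eq_bigr => o /CC' ->.
Qed.
End Independence.

(** * Bounds on the optimum and on any schedule for a fixed cost sequence *)

Section Contracts.
Context (R : realType).
Implicit Types (x : nat -> R) (t : nat -> nat).

Fixpoint prefix_min x (s : nat) : R :=
  if s is s'.+1 then Num.min (prefix_min x s') (x s) else x 0.

Fixpoint prefix_argmin x (s : nat) : nat :=
  if s is s'.+1 then
    if x (prefix_argmin x s') <= x s then prefix_argmin x s' else s
  else 0.

Lemma prefix_minE x s : prefix_min x s = x (prefix_argmin x s).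
Proof.
by elim: s => //= s ->; rewrite minEle; case: ifP.
Qed.

Lemma prefix_argmin_le x s : (prefix_argmin x s <= s)%N.
Proof. by elim: s => //= s IH; case: ifP => // _; rewrite (leq_trans IH). Qed.

(** The minimizer at time [s] has been the minimizer ever since its arrival, so one contract can
    serve all its time steps. *)
Lemma prefix_argmin_between x s r : (prefix_argmin x s <= r <= s)%N ->
  prefix_argmin x r = prefix_argmin x s.
Proof.
elim: s => [|s IH]; first by rewrite leqn0 => /andP[_ /eqP->].
rewrite [in RHS]/= [X in (X <= _)%N]/=; case: ifP => xs.
  move=> /andP[sr]; rewrite leq_eqVlt => /orP[/eqP->/=|]; first by rewrite xs.
  by rewrite ltnS => rs; apply: IH; rewrite sr.
move=> rs; have -> : r = s.+1 by lia.
by rewrite /= xs.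
Qed.

Lemma opt_ge0 n x : (forall i, (i < n)%N -> 0 <= x i) -> 0 <= opt n x.
Proof.
move=> x0; rewrite /opt; set C := (X in inf X).
(* The infimum of the empty set is 0 by convention, so no feasible schedule has to be exhibited. *)
have [->|/set0P ne] := eqVneq C set0.
  by rewrite inf0.
apply: lb_le_inf => // _ [t _ <-].
by apply: sumr_ge0 => i _; rewrite mulr_ge0// x0.
Qed.

Lemma opt_le_sum_prefix_min n x : (forall i, (i < n)%N -> 0 <= x i) ->
  opt n x <= \sum_(s < n) prefix_min x s.
Proof.
(* Applicant [i] is hired for as many steps as it stays the prefix minimizer. *)
move=> x0; pose t i := (\sum_(s < n) (prefix_argmin x s == i))%N.
have -> : \sum_(s < n) prefix_min x s = cost n x t.
  rewrite /cost; under [RHS]eq_bigr do rewrite natr_sum mulr_suml.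
  rewrite exchange_big/=; apply: eq_bigr => s _.
  have sn : (prefix_argmin x s < n)%N.
    exact: leq_ltn_trans (prefix_argmin_le x s) (ltn_ord s).
  rewrite prefix_minE (bigD1 (Ordinal sn))//= eqxx mul1r big1 ?addr0// => i.
  by rewrite -val_eqE /= eq_sym => /negbTE ->; rewrite mul0r.
apply: ge_inf.
  exists 0 => _ [u _ <-].
  by apply: sumr_ge0 => i _; rewrite mulr_ge0// x0.
exists t => // s sn; exists (prefix_argmin x s).
  exact: leq_ltn_trans (prefix_argmin_le x s) sn.
rewrite /under_contract prefix_argmin_le /=.
set a := prefix_argmin x s.
(* All steps from [a] to [s] have minimizer [a], so its contract lasts at least [s - a + 1] steps
   and reaches [s]. *)
have : (\sum_(r < n | (a <= r <= s)%N) 1 <= t a)%N.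
  rewrite big_mkcond; apply: leq_sum => r _; case: ifP => // rs.
  by rewrite (prefix_argmin_between rs) eqxx.
have -> : (\sum_(r < n | (a <= r <= s)%N) 1 = \sum_(a <= r < s.+1) 1)%N.
  rewrite (big_nat_widen _ _ n)//= (big_nat_widenl _ 0)//.
  by rewrite big_mkord; apply: eq_bigl => r; rewrite ltnS andbC.
rewrite sum_nat_const_nat muln1.
by have := prefix_argmin_le x s; rewrite -/a; lia.
Qed.

(** Only the ends of contracts are tested: for [i <= s + 1] the first [i] applicants have all
    arrived by time [s]. The value depends on the first [i] decisions alone. *)
Definition uncovered t (i s : nat) : bool :=
  all (fun j => j + t j <= s)%N (iota 0 i).

Definition first_cover t (i s : nat) : bool :=
  uncovered t i s && ~~ uncovered t i.+1 s.

Lemma uncoveredS t i s :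
  uncovered t i.+1 s = uncovered t i s && (i + t i <= s)%N.
Proof. by rewrite /uncovered -addn1 iotaD all_cat /= andbT. Qed.

Lemma feasible_uncovered n t s : feasible n t -> (s < n)%N ->
  uncovered t s.+1 s = false.
Proof.
move=> ft /ft[i _ /andP[ls lt]]; apply/negbTE/allPn.
by exists i; [rewrite mem_iota add0n ltnS|rewrite -ltnNge].
Qed.

Lemma sum_nat_window (n i t : nat) : (\sum_(s < n) (i <= s < i + t) <= t)%N.
Proof.
suff -> : (\sum_(s < n) (i <= s < i + t) = minn (n - i) t)%N by exact: geq_minr.
elim: n => [|n IH]; first by rewrite big_ord0; lia.
by rewrite big_ord_recr /= IH; case: (boolP (i <= n < i + t)%N) => /=; lia.
Qed.

Lemma sum_first_cover_le_cost n x t : (forall i, (i < n)%N -> 0 <= x i) ->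
  \sum_(s < n) \sum_(i < s.+1) (first_cover t i s)%:R * x i <= cost n x t.
Proof.
(* Extending the inner range to [n] allows exchanging the sums; each [i] is then charged only inside
   its own contract window. *)
move=> x0; have E (s : 'I_n) : \sum_(i < s.+1) (first_cover t i s)%:R * x i =
    \sum_(i < n) ((i <= s)%N && first_cover t i s)%:R * x i.
  rewrite (big_ord_widen n (fun i => (first_cover t i s)%:R * x i))//.
  rewrite big_mkcond; apply: eq_bigr => i _; rewrite ltnS.
  by case: ifP => //=; rewrite mul0r.
under eq_bigr do rewrite E.
rewrite exchange_big; apply: ler_sum => i _.
rewrite -mulr_suml ler_wpM2r ?x0// -natr_sum ler_nat.
apply: leq_trans (sum_nat_window n i (t i)); apply: leq_sum => s _.
rewrite /first_cover uncoveredS; case: (i <= s)%N => //=.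
by case: (uncovered t i s) => //=; rewrite ltnNge.
Qed.

End Contracts.

(** * Measurability of events determined by past decisions *)

Section Histories.
Context (R : realType) (d dS : measure_display).
Context (T : measurableType d) (S : measurableType dS).
Context (A : online_rule R S).

Lemma measurable_mktuple (X : nat -> T -> R) (k : nat) :
  (forall j, (j < k)%N -> measurable_fun setT (X j)) ->
  measurable_fun setT (fun w => [tuple X i w | i < k]).
Proof.
move=> mX; apply/measurable_fun_tnthP => i.
by apply: (eq_measurable_fun (X i)) => [w _|];
  [rewrite /= tnth_mktuple|exact: mX].
Qed.

Lemma mktuple_mkseq (f : nat -> R) (k : nat) :
  tval [tuple f i | i < k] = mkseq f k.
Proof. by rewrite /= /mkseq -val_enum_ord -map_comp. Qed.

(** By induction on [i], since a rule is measurable for each fixed list of earlier decisions. Only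
    the costs before [i] need be measurable, which lets the lemma be applied to a coarser
    sigma-algebra on [T]. *)
Lemma measurable_history_eq (U : T -> S) (X : nat -> T -> R) (n i : nat)
    (h : seq nat) :
  measurable_rule A -> measurable_fun setT U ->
  (forall j, (j < i)%N -> measurable_fun setT (X j)) ->
  measurable [set w | history A n (U w) (X^~ w) i = h].
Proof.
move=> mA mU; elim: i h => [|i IH] h mX /=.
  have [->|h0] := eqVneq h [::].
    by rewrite (_ : [set _ | _] = setT)//; exact/seteqP.
  rewrite (_ : [set _ | _] = set0)//; apply/seteqP; split => // w /= /esym/eqP.
  exact/negP.
case/lastP: h => [|h a].
  rewrite (_ : [set _ | _] = set0)//; apply/seteqP; split => // w /=.
  by move=> /(congr1 size); rewrite size_rcons.
rewrite (_ : [set _ | _] = [set w | history A n (U w) (X^~ w) i = h] `&`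
   ((fun w => A n (U w) (mkseq (X^~ w) i.+1) h) @^-1` [set a])); last first.
  apply/seteqP; split => w /=.
    by move=> /rcons_inj[-> <-].
  by move=> [-> <-].
apply: measurableI; first by apply: IH => j /ltnW; exact: mX.
rewrite -[X in measurable X]setTI.
have mf : measurable_fun setT (fun w => A n (U w) (mkseq (X^~ w) i.+1) h).
  rewrite (_ : (fun _ => _) =
      fun w => A n (U w) (tval [tuple X j w | j < i.+1]) h); last first.
    by apply/funext => w; rewrite (mktuple_mkseq (X^~ w)).
  have mp : measurable_fun setT (fun w => (U w, [tuple X j w | j < i.+1])).
    by apply: measurable_fun_pair => //; exact: measurable_mktuple.
  exact: measurableT_comp (mA n i h) mp.
exact: mf.
Qed.

Lemma measurable_history_pred (U : T -> S) (X : nat -> T -> R) (n i : nat)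
    (Q : pred (seq nat)) :
  measurable_rule A -> measurable_fun setT U ->
  (forall j, (j < i)%N -> measurable_fun setT (X j)) ->
  measurable [set w | Q (history A n (U w) (X^~ w) i)].
Proof.
move=> mA mU mX.
(* There are countably many histories. Codes of no sequence are excluded by the default [false], so
   the default [[::]] never occurs. *)
rewrite (_ : [set _ | _] =
   \bigcup_(k in [set k : nat | oapp Q false (choice.unpickle k)])
   [set w | history A n (U w) (X^~ w) i = odflt [::] (choice.unpickle k)]).
  by apply: bigcup_measurable => k _; exact: measurable_history_eq.
apply/seteqP; split => w.
  move=> Qh; exists (choice.pickle (history A n (U w) (X^~ w) i));
  by rewrite /mkset choice.pickleK.
by move=> [k]; rewrite /mkset; case: choice.unpickle => //= h Qh ->.
Qed.

Lemma nth_history n (u : S) (x : nat -> R) i j : (j < i)%N ->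
  nth 0%N (history A n u x i) j = decision A n u x j.
Proof.
have sz k : size (history A n u x k) = k.
  by elim: k => //= k IH; rewrite size_rcons IH.
elim: i => // i IH; rewrite ltnS leq_eqVlt => /predU1P[->|ji] /=.
  by rewrite nth_rcons sz ltnn eqxx.
by rewrite nth_rcons sz ji IH.
Qed.

Lemma measurable_uncovered (U : T -> S) (X : nat -> T -> R) (n i s : nat) :
  measurable_rule A -> measurable_fun setT U ->
  (forall j, (j < i)%N -> measurable_fun setT (X j)) ->
  measurable [set w | uncovered (decision A n (U w) (X^~ w)) i s].
Proof.
move=> mA mU mX; have := measurable_history_pred n
  (fun h => all (fun j => j + nth 0%N h j <= s)%N (iota 0 i)) mA mU mX.
congr (measurable _); apply/funext => w; congr is_true.
by apply: eq_in_all => j; rewrite mem_iota add0n => ji; rewrite nth_history.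
Qed.

End Histories.

(** * Growth of the stopping values against the harmonic sum *)

Section Asymptotics.
Context (R : realType).

(* [stop_value j] is the optimal expected price when stopping among [j] fresh
   uniform costs, the value 1 standing for having none left. *)
Fixpoint stop_value (j : nat) : R :=
  if j is j'.+1 then stop_value j' - stop_value j' ^+ 2 / 2 else 1.

Lemma stop_value_itv j : 0 < stop_value j <= 1.
Proof.
elim: j => [|j /andP[h0 h1]] /=; first by rewrite ltr01 lexx.
by apply/andP; split; nra.
Qed.

(* For [a < 2] the sequence [a / (j + D)] is a subsolution of the recursion
   defining [stop_value] once [D] is large. *)
Lemma stop_value_ge (a : R) (D j : nat) :
  0 < a <= D%:R -> a <= D%:R * (2 - a) ->
  a / (j + D)%:R <= stop_value j.
Proof.
move=> /andP[a0 aD] aD2; have D0 : 0 < D%:R :> R by exact: lt_le_trans aD.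
elim: j => [|j IH] /=.
  by rewrite add0n ler_pdivrMr ?mul1r.
have /andP[h0 h1] := stop_value_itv j.
have Db : D%:R <= (j + D)%:R :> R by rewrite ler_nat leq_addl.
have b0 := lt_le_trans D0 Db.
have -> : (j.+1 + D)%:R = (j + D)%:R + 1 :> R by rewrite addSn -natr1.
move: (stop_value j) (j + D)%:R h0 h1 b0 Db IH => w b w0 w1 b0 Db IH.
have ab1 : a / b <= 1 by rewrite ler_pdivrMr// mul1r (le_trans aD).
have ab0 : 0 <= a / b by rewrite divr_ge0 ?ltW.
(* The map [w - w ^+ 2 / 2] is increasing on the unit interval, so [w] may be replaced by its lower
   bound [a / b]. *)
apply: (@le_trans _ _ (a / b - (a / b) ^+ 2 / 2)); last by nra.
rewrite -subr_ge0.
have -> : a / b - (a / b) ^+ 2 / 2 - a / (b + 1) =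
    a * (b * (2 - a) - a) / (2 * b ^+ 2 * (b + 1)).
  by field; rewrite !gt_eqF// addr_gt0.
apply: divr_ge0; last by rewrite !mulr_ge0 ?sqr_ge0// ltW// addr_gt0.
rewrite mulr_ge0 ?(ltW a0)// subr_ge0 (le_trans aD2)// ler_wpM2r//.
by nra.
Qed.

(** Each further unit shift of the denominators loses a telescoping sum, which is at most 1. *)
Lemma harmonic_shift_ge (D n : nat) :
  \sum_(s < n) (s.+2%:R^-1 : R) - D%:R <= \sum_(s < n) (s.+1 + D.+1)%:R^-1.
Proof.
elim: D => [|D IH].
  by rewrite subr0; apply: ler_sum => s _; rewrite addn1.
rewrite -natr1 opprD addrA; apply: le_trans (lerD IH (lexx _)) _.
rewrite lerBlDr -lerBlDl -sumrB.
rewrite (_ : \sum_(s < n) _ = D.+2%:R^-1 - (n + D.+2)%:R^-1).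
  apply: (@le_trans _ _ D.+2%:R^-1); first by rewrite gerBl invr_ge0.
  by rewrite invf_le1 ?ler1n// ltr0n.
elim: n {IH} => [|n IH]; first by rewrite big_ord0 add0n subrr.
rewrite big_ord_recr /= IH.
have -> : (n.+1 + D.+1 = n + D.+2)%N by lia.
by rewrite addrA subrK.
Qed.

Lemma harmonic_cvgy : (fun n => \sum_(s < n) (s.+2%:R^-1 : R)) @ \oo --> +oo.
Proof.
have H : series (@harmonic R) @ \oo --> +oo.
  apply: nondecreasing_dvgn_lt; last exact: dvg_harmonic.
  apply: nondecreasing_series => n _ _; exact: harmonic_ge0.
apply/cvgryPge => M.
have /cvgryPge/(_ (M + 1))[k _ kM] := H.
exists k => // n /= kn; rewrite -(lerD2r 1).
apply: le_trans (kM n.+1 _) _ => /=; first exact: leqW.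
by rewrite /series /= big_mkord big_ord_recl /= invr1 addrC.
Qed.

Lemma stop_value_ratio_ge (e : R) : 0 < e <= 1 -> \forall n \near \oo,
  0 < \sum_(s < n) (s.+2%:R^-1 : R) /\
  2 - e <= (\sum_(s < n) stop_value s.+1) / \sum_(s < n) (s.+2%:R^-1 : R).
Proof.
(* [stop_value_ge] will be used with [a = 2 - e / 2]: [D >= 4 / e] gives [a <= 2 <= D * (2 - a)],
   and the two successors give [a <= 2 <= D]. *)
move=> /andP[e0 e1]; set D := (Num.bound (4 / e)).+2.
have eD : 4 <= e * D%:R.
  rewrite mulrC -ler_pdivrMr//.
  have /archi_boundP : 0 <= 4 / e by rewrite divr_ge0// ltW.
  move=> /ltW /le_trans; apply; rewrite ler_nat /D; lia.
have D2 : 2 <= D%:R :> R by rewrite ler_nat.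
(* This threshold absorbs the shift: [(2 - e / 2) * D <= 2 * D <= (e / 2) * H]. *)
have /cvgryPge/(_ (4 * D%:R / e))[k _ kM] := harmonic_cvgy.
exists k => // n /= /kM /=; set H := \sum_(s < n) _ => HM.
have H0 : 0 < H.
  apply: lt_le_trans HM.
  by rewrite divr_gt0// mulr_gt0// (lt_le_trans _ D2).
split=> //; rewrite ler_pdivlMr//.
have W : (2 - e / 2) * (H - D%:R) <= \sum_(s < n) stop_value s.+1.
  have := harmonic_shift_ge D.-1 n; rewrite -/H => HS.
  apply: (@le_trans _ _ ((2 - e / 2) * \sum_(s < n) (s.+1 + D)%:R^-1)).
    rewrite ler_wpM2l//; first by lra.
    apply: le_trans HS; rewrite lerD2l lerN2 ler_nat; exact: leq_pred.
  rewrite mulr_sumr; apply: ler_sum => s _; apply: stop_value_ge.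
    by apply/andP; split; lra.
  by nra.
apply: le_trans W.
have : 4 * D%:R <= H * e by rewrite -ler_pdivrMr.
nra.
Qed.

(** When [y = 0] its inverse is infinite, and so is the quotient because [x] is positive. *)
Lemma le_divee (x y : \bar R) (w h : R) : 0 < w -> 0 < h ->
  (w%:E <= x)%E -> (0 <= y)%E -> (y <= h%:E)%E -> ((w / h)%:E <= x / y)%E.
Proof.
move=> w0 h0 wx; case: y => [r| |] //; rewrite !lee_fin => r0 rh.
have [->|rn0] := eqVneq r 0.
  by rewrite inve0 gt0_muley ?leey// (lt_le_trans _ wx)// lte_fin.
have {r0 rn0}r0 : 0 < r by rewrite lt_neqAle eq_sym rn0.
rewrite inver gt_eqF//; apply: (@le_trans _ _ (w%:E * r^-1%:E)%E).
  by rewrite -EFinM lee_fin ler_pM2l// lef_pV2.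
by apply: lee_wpmul2r => //; rewrite lee_fin invr_ge0 ltW.
Qed.

End Asymptotics.

(** * Expected optimum and expected cost of an online rule *)

Section Costs.
Context (R : realType) (d dS : measure_display).
Context (T : measurableType d) (P : probability T R).
Context (S : measurableType dS) (U : {mfun T >-> S}) (X : nat -> {RV P >-> R}).
Context (hX : forall (i : nat) (B : set R), measurable B ->
  distribution P (X i) B = uniform_prob (@ltr01 R) B).
Context (hindep : mutually_independent P (seed_cost_sigma U (fun i => X i))).

Lemma cost_gt_prob i (t : R) : 0 <= t <= 1 ->
  P [set w | t < X i w] = (1 - t)%:E.
Proof.
move=> /andP[t0 t1]; have := @hX i `]t, +oo[ (measurable_itv _).
rewrite /distribution /pushforward /uniform_prob integral_uniform_pdf.
have -> : X i @^-1` `]t, +oo[ = [set w | t < X i w].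
  by apply/seteqP; split => w /=; rewrite in_itv/= andbT.
move=> ->; have -> : `]t, +oo[ `&` `[(0:R), 1] = `]t, 1]%classic.
  apply/seteqP; split => y /=; rewrite !in_itv/= andbT.
    by move=> [-> /andP[]].
  by move=> /andP[ty ->]; rewrite ty (ltW (le_lt_trans t0 ty)).
rewrite (eq_integral (fun=> 1%E)); last first.
  move=> y; rewrite inE/= in_itv/= => /andP[ty y1].
  by rewrite /uniform_pdf y1 (ltW (le_lt_trans t0 ty)) subr0 invr1.
rewrite integral_cst//= mul1e lebesgue_measure_itv/= lte_fin.
have [_|t1'] := ltP t 1; first by rewrite EFinB.
by rewrite (le_anti (introT andP (conj t1 t1'))) subrr.
Qed.

(** The costs lie in the unit interval only almost surely, while [feasible_rule] speaks of costs
    inside it. One null set collects the countably many exceptions. *)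
Lemma costs_in01 : exists N : set T, [/\ measurable N, P N = 0%E &
  forall w, ~ N w -> forall i, 0 <= X i w <= 1].
Proof.
pose N i := X i @^-1` (~` `[0, 1]).
have mN i : measurable (N i).
  rewrite -[N i]setTI; apply: measurable_funPT => //; exact: measurableC.
have N0 i : P (N i) = 0%E.
  have m01 : measurable (X i @^-1` `[0, 1]).
    by rewrite -[X in measurable X]setTI; exact: measurable_funPT.
  rewrite /N preimage_setC probability_setC//.
  have := @hX i `[0, 1] (measurable_itv _).
  rewrite /distribution /pushforward => ->.
  by rewrite /uniform_prob (integral_uniform_pdf1 (@ltr01 R))// subee.
exists (\bigcup_i N i); split.
- exact: bigcupT_measurable.
- apply/negligibleP; first exact: bigcupT_measurable.
  by apply: negligible_bigcup => k; exists (N k); split => //; exact: N0.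
- move=> w Nw i; apply/negPn/negP => H; apply: Nw; exists i => //=.
  by rewrite /N/= in_itv/=; apply/negP.
Qed.

(** The space [T] with a coarser sigma-algebra, all of whose events are independent of [X i]. *)
Local Notation past i :=
  (g_sigma_algebraType (other_cylinders U (fun j => X j) i)).

Lemma past_seed i : @measurable_fun _ _ (past i) S setT U.
Proof.
move=> _ Y mY; apply: sub_gen_smallest.
exists [fset None]%fset; first by rewrite inE.
exists (fun o => if o is None then setT `&` U @^-1` Y else setT).
  by case=> [j|]; [exact: seed_cost_sigmaT|exists Y].
by rewrite set_fset1 bigcap_set1.
Qed.

Lemma past_cost i j : (j < i)%N -> @measurable_fun _ _ (past i) R setT (X j).
Proof.
move=> ji _ Y mY; apply: sub_gen_smallest.
exists [fset Some j]%fset.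
  by rewrite inE; apply/eqP => -[ij]; rewrite ij ltnn in ji.
exists (fun o => if o == Some j then setT `&` X j @^-1` Y else setT).
  by move=> o; case: eqP => [->|_]; [exists Y|exact: seed_cost_sigmaT].
by rewrite set_fset1 bigcap_set1 eqxx.
Qed.

(** Here the rule being online enters: whether the first [i] contracts reach past [s] is settled
    before [X i] is revealed. *)
Lemma indep_uncovered (A : online_rule R S) n i s (B : set R) :
  measurable_rule A -> measurable B ->
  let E := [set w | uncovered (decision A n (U w) (fun j => X j w)) i s] in
  P (E `&` X i @^-1` B) = (P E * P (X i @^-1` B))%E.
Proof.
move=> mA mB; apply: (indep_other_costs hindep _ mB).2.
apply: (@measurable_uncovered _ _ _ (past i)) => //; first exact: past_seed.
by move=> j; exact: past_cost.
Qed.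

Lemma costs_gt_prob k (t : R) : 0 <= t <= 1 ->
  P [set w | forall j, (j < k)%N -> t < X j w] = ((1 - t) ^+ k)%:E.
Proof.
move=> t01; elim: k => [|k IH].
  by rewrite (_ : [set _ | _] = setT) ?probability_setT//; apply/seteqP.
rewrite (_ : [set _ | _] =
    [set w | forall j, (j < k)%N -> t < X j w] `&` X k @^-1` `]t, +oo[);
    last first.
  apply/seteqP; split => w /=.
    by move=> H; split => [j jk|]; [apply: H; exact: ltnW|rewrite in_itv/= H].
  move=> [H]; rewrite in_itv/= andbT => Hk j.
  by rewrite ltnS leq_eqVlt => /predU1P[->//|]; exact: H.
rewrite (indep_other_costs hindep _ _).2//; last first.
  rewrite (_ : [set _ | _] =
      \bigcap_(j in [set j | (j < k)%N]) X j @^-1` `]t, +oo[); last first.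
    apply/seteqP; split => w /= H j jk; have := H j jk;
    by rewrite /= in_itv/= andbT.
  apply: (@fin_bigcap_measurable _ (past k)); first exact: finite_II.
  by move=> j jk; rewrite -[X in measurable X]setTI; exact: past_cost.
rewrite IH (_ : X k @^-1` _ = [set w | t < X k w]); last first.
  by apply/seteqP; split => w /=; rewrite in_itv/= andbT.
by rewrite cost_gt_prob// -EFinM exprSr.
Qed.

Lemma expectation_opt_ge0 n : (0 <= 'E_P[fun w => opt n (fun i => X i w)])%E.
Proof.
have [N [mN N0 XN]] := costs_in01; rewrite expectation.unlock.
apply: (@le_trans _ _ (\int[P]_w (cst 0%E w))%E); first by rewrite integral0.
apply: (@le_integral_off_null _ _ _ P N) => // w Nw.
by rewrite lee_fin opt_ge0// => i _; have /andP[] := XN w Nw i.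
Qed.

(** Almost surely equal to [X i], but bounded everywhere, as the tail formula requires. *)
Local Notation clip i := (fun w => Num.min (Num.max (X i w) 0) 1).

Lemma clip_itv i w : 0 <= clip i w <= 1.
Proof. by rewrite le_min le_max lexx orbT ler01/= ge_min lexx orbT. Qed.

Lemma prefix_min_clip_itv s w : 0 <= prefix_min (fun i => clip i w) s <= 1.
Proof. by rewrite prefix_minE; exact: clip_itv. Qed.

Lemma measurable_prefix_min_clip s :
  measurable_fun setT (fun w => prefix_min (fun i => clip i w) s).
Proof.
have mc i : measurable_fun setT (clip i).
  by apply: measurable_minr => //; exact: measurable_maxr.
by elim: s => [|s IH] /=; [exact: mc|exact: measurable_minr].
Qed.

Lemma prefix_min_clip_mean s :
  (\int[P]_w (prefix_min (fun i => clip i w) s)%:E = (s.+2%:R^-1)%:E)%E.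
Proof.
rewrite (@expectation_tail_onemX _ _ _ P _ s.+1 1 1)//.
- by rewrite subrr expr0n /= subr0 !mul1r.
- exact: measurable_prefix_min_clip.
- by rewrite ltr01 lexx.
- by move=> w; exact: prefix_min_clip_itv.
- move=> t /andP[t0 t1]; rewrite mul1r -(costs_gt_prob) ?t0 ?ltW//.
  (* For [0 <= t < 1] clipping does not affect the comparison with [t]. *)
  congr (P _); apply/seteqP; split => w /=.
    elim: s => [|s IH] /=.
      by rewrite lt_min lt_max (ltNge t 0) t0 orbF => /andP[tX _] [].
    rewrite [in X in X -> _]lt_min => /andP[/IH{}IH].
    rewrite lt_min lt_max (ltNge t 0) t0 orbF => /andP[tX _] j.
    by rewrite ltnS leq_eqVlt => /predU1P[->//|]; exact: IH.
  move=> H; rewrite prefix_minE lt_min t1 andbT lt_max H//.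
  by rewrite ltnS prefix_argmin_le.
Qed.

Lemma expectation_opt_le n :
  ('E_P[fun w => opt n (fun i => X i w)] <= (\sum_(s < n) s.+2%:R^-1)%:E)%E.
Proof.
have [N [mN N0 XN]] := costs_in01; rewrite expectation.unlock -sumEFin.
under eq_bigr do rewrite -prefix_min_clip_mean.
rewrite -(@ge0_integral_sum _ _ _ P setT measurableT _
  (fun (s : 'I_n) w => (prefix_min (fun i => clip i w) s)%:E)); last 2 first.
- by move=> s; apply/measurable_EFinP; exact: measurable_prefix_min_clip.
- by move=> s w _; rewrite lee_fin; have /andP[] := prefix_min_clip_itv s w.
apply: (@le_integral_off_null _ _ _ P N) => // w Nw.
rewrite sumEFin lee_fin.
have -> : (fun i => clip i w) = (fun i => X i w).
  by apply/funext => i; have /andP[x0 x1] := XN w Nw i; rewrite max_l// min_l.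
by apply: opt_le_sum_prefix_min => i _; have /andP[] := XN w Nw i.
Qed.

Context (A : online_rule R S) (Ameas : measurable_rule A).

Local Notation dec n := (fun w => decision A n (U w) (fun j => X j w)).
Local Notation uncov n i s := [set w | uncovered (dec n w) i s].

Lemma measurable_uncov n i s : measurable (uncov n i s).
Proof. by apply: (@measurable_uncovered _ _ _ T S A U (fun j => X j)). Qed.

Lemma measurable_posX i : measurable_fun setT (fun w => Num.max (X i w) 0).
Proof. exact: measurable_maxr. Qed.

Lemma measurable_first_cover n i s :
  measurable_fun setT
    (fun w => (first_cover (dec n w) i s)%:R * Num.max (X i w) 0).
Proof.
apply: measurable_funM; last exact: measurable_posX.
rewrite (_ : (fun _ => _) = \1_(uncov n i s `\` uncov n i.+1 s)).
  apply: measurable_indic; apply: measurableD; exact: measurable_uncov.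
apply/funext => w; rewrite indicE /first_cover; congr _%:R; congr nat_of_bool.
apply/idP/idP => [/andP[H1 /negP H2]|]; first by rewrite inE; split.
by rewrite inE => -[/= H1 /negP H2]; apply/andP.
Qed.

(** By independence the mean factors, and [c - c ^+ 2 / 2] is the mean of a uniform cost truncated
    at [c]. *)
Lemma uncovered_truncated_mean n i s (c : R) : 0 < c <= 1 ->
  (\int[P]_w (\1_(uncov n i s) w * Num.min (Num.max (X i w) 0) c)%:E =
   (fine (P (uncov n i s)) * (c - c ^+ 2 / 2))%:E)%E.
Proof.
move=> c01; have /andP[c0 c1] := c01.
have mE := measurable_uncov n i s.
rewrite (@expectation_tail_onemX _ _ _ P _ 1 c (fine (P (uncov n i s))))//.
- by congr EFin; field.
- apply: measurable_funM; first exact: measurable_indic.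
  by apply: measurable_minr => //; exact: measurable_posX.
- by rewrite fine_ge0.
- move=> w; rewrite indicE; case: (_ \in _); last by rewrite mul0r lexx ltW.
  by rewrite mul1r le_min le_max lexx orbT (ltW c0) ge_min lexx orbT.
- move=> t /andP[t0 tc].
  have -> : [set w | t < \1_(uncov n i s) w * Num.min (Num.max (X i w) 0) c] =
      uncov n i s `&` X i @^-1` `]t, +oo[.
    apply/seteqP; split => w /=; rewrite indicE in_itv/= andbT.
      case: (boolP (w \in _)) => [/set_mem Ew|_]; last first.
        by rewrite mul0r ltNge t0.
      by rewrite mul1r lt_min lt_max tc andbT (ltNge t 0) t0 orbF.
    by move=> [H tX]; rewrite mem_set// mul1r lt_min lt_max tX tc.
  rewrite indep_uncovered// (_ : X i @^-1` _ = [set w | t < X i w]); last first.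
    by apply/seteqP; split => w /=; rewrite in_itv/= andbT.
  rewrite cost_gt_prob//; last by rewrite t0 (le_trans (ltW tc)).
  by rewrite -(fineK (fin_num_measure P _ mE)) -EFinM expr1.
Qed.

(** One step of optimal stopping with continuation value [c]: while [s] is uncovered, applicant [i]
    either covers it at price [X i] or leaves it open at price [c], so at least the smaller of the
    two is paid. *)
Lemma stopping_step n i s (c : R) : 0 < c <= 1 ->
  ((fine (P (uncov n i s)) * (c - c ^+ 2 / 2))%:E <=
   \int[P]_w ((first_cover (dec n w) i s)%:R * Num.max (X i w) 0)%:E +
   (c * fine (P (uncov n i.+1 s)))%:E)%E.
Proof.
move=> c01; have /andP[c0 c1] := c01; rewrite -uncovered_truncated_mean//.
have mE := measurable_uncov n i.+1 s.
have -> : (c * fine (P (uncov n i.+1 s)))%:E =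
    (\int[P]_w (c * \1_(uncov n i.+1 s) w)%:E)%E.
  under eq_integral do rewrite EFinM.
  rewrite ge0_integralZl//.
  - by rewrite integral_indic// setIT EFinM fineK// fin_num_measure.
  - by apply/measurable_EFinP; exact: measurable_indic.
  - by rewrite lee_fin ltW.
have mF := measurable_first_cover n i s.
rewrite -ge0_integralD//; first last.
- apply/measurable_EFinP; apply: measurable_funM => //; exact: measurable_indic.
- by move=> w _; rewrite lee_fin mulr_ge0// ltW.
- exact/measurable_EFinP.
- by move=> w _; rewrite lee_fin mulr_ge0// le_max lexx orbT.
apply: (@le_integral_off_null _ _ _ P set0); rewrite ?measure0// => w _.
rewrite -EFinD lee_fin /first_cover uncoveredS !indicE.
have inE' j : (w \in uncov n j s) = uncovered (dec n w) j s.
  by apply/idP/idP => [/set_mem|/mem_set].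
rewrite !inE' uncoveredS; case: (uncovered _ i s) => /=; last first.
  by rewrite !mul0r mulr0 addr0.
case: (_ <= _)%N => /=.
  by rewrite mul0r add0r mul1r mulr1 ge_min lexx orbT.
by rewrite !mul1r mulr0 addr0 ge_min lexx.
Qed.

Lemma stop_value_le n s : feasible_rule A -> (s < n)%N ->
  ((stop_value R s.+1)%:E <= \sum_(i < s.+1)
     \int[P]_w ((first_cover (dec n w) i s)%:R * Num.max (X i w) 0)%:E)%E.
Proof.
move=> Afeas sn; set a := fun i =>
  (\int[P]_w ((first_cover (dec n w) i s)%:R * Num.max (X i w) 0)%:E)%E.
(* After [k] applicants: the charges so far, plus the value of stopping among the remaining
   [s + 1 - k], weighted by the probability that [s] is still open. *)
have H k : (k <= s.+1)%N -> ((stop_value R s.+1)%:E <= \sum_(i < k) a i +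
    (stop_value R (s.+1 - k) * fine (P (uncov n k s)))%:E)%E.
  elim: k => [|k IH] ks.
    rewrite big_ord0 add0e subn0 (_ : uncov n 0 s = setT); last exact/seteqP.
    by rewrite probability_setT mulr1.
  apply: le_trans (IH (ltnW ks)) _.
  rewrite big_ord_recr /= -addeA leeD2l//.
  have -> : (s.+1 - k = (s - k).+1)%N by lia.
  by rewrite subSS /= mulrC; apply: stopping_step; exact: stop_value_itv.
have := H s.+1 (leqnn _).
(* Off the null set the schedule is feasible, so [s] is covered by one of the applicants up to
   [s]. *)
rewrite (_ : P (uncov n s.+1 s) = 0%E) ?mulr0 ?adde0//.
have [N [mN N0 XN]] := costs_in01.
apply/eqP; rewrite eq_le measure_ge0 andbT -N0 le_measure ?inE//.
  exact: measurable_uncov.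
move=> w /= uw; apply: contrapT => Nw.
by move: uw; rewrite (@feasible_uncovered n)//; apply: Afeas => j _; exact: XN.
Qed.

Lemma expectation_alg_ge n : feasible_rule A ->
  ((\sum_(s < n) stop_value R s.+1)%:E <=
   'E_P[fun w => alg A n (U w) (fun i => X i w)])%E.
Proof.
move=> Afeas; have [N [mN N0 XN]] := costs_in01.
rewrite expectation.unlock.
apply: (@le_trans _ _ (\int[P]_w (\sum_(s < n) \sum_(i < s.+1)
   ((first_cover (dec n w) i s)%:R * Num.max (X i w) 0)%:E))%E); last first.
  (* Off [N] the costs equal their positive parts, so the pointwise charging bound applies. *)
  apply: (@le_integral_off_null _ _ _ P N) => // w Nw.
  under eq_bigr do rewrite sumEFin.
  rewrite sumEFin lee_fin.
  apply: le_trans (@sum_first_cover_le_cost _ n (fun i => X i w) (dec n w) _).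
    apply: ler_sum => s _; apply: ler_sum => i _.
    by rewrite max_l//; have /andP[] := XN w Nw i.
  by move=> i _; have /andP[] := XN w Nw i.
have H0 s i w :
    (0 <= ((first_cover (dec n w) i s)%:R * Num.max (X i w) 0)%:E)%E.
  by rewrite lee_fin mulr_ge0// le_max lexx orbT.
have mF s i : measurable_fun setT (fun w =>
    ((first_cover (dec n w) i s)%:R * Num.max (X i w) 0)%:E : \bar R).
  by apply/measurable_EFinP; exact: measurable_first_cover.
rewrite ge0_integral_sum//; last 2 first.
- by move=> s; apply: emeasurable_sum.
- by move=> s w _; apply: sume_ge0.
rewrite -sumEFin; apply: lee_sum => s _.
rewrite ge0_integral_sum//; exact: stop_value_le.
Qed.

End Costs.

(** * Passage to the limit superior *)

Theorem theorem4p8 (R : realType) (d dS : measure_display)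
    (T : measurableType d) (P : probability T R)
    (S : measurableType dS) (U : {mfun T >-> S}) (X : nat -> {RV P >-> R})
    (hX : forall (i : nat) (B : set R), measurable B ->
       distribution P (X i) B = uniform_prob (@ltr01 R) B)
    (hindep : mutually_independent P (seed_cost_sigma U (fun i => X i)))
    (A : online_rule R S)
    (Ameas : measurable_rule A) (Afeas : feasible_rule A) :
  (2%:E <= limn_esup (fun n : nat =>
     'E_P[fun w : T => alg A n (U w) (fun i => X i w)] /
     'E_P[fun w : T => opt n (fun i => X i w)]))%E.
Proof.
set u := (X in limn_esup X).
suff H (e : R) : 0 < e <= 1 -> ((2 - e)%:E <= limn_esup u)%E.
  apply/lee_addgt0Pr => e e0.
  rewrite -leeBlDr// -EFinB; apply: (@le_trans _ _ (2 - Num.min e 1)%:E).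
    by rewrite lee_fin lerB// ge_min lexx.
  by apply: H; rewrite lt_min e0 ltr01 ge_min lexx orbT.
move=> e01; have [k _ kH] := stop_value_ratio_ge e01.
(* The limit superior is an infimum over eventual sets [B] of suprema over [B]; one index of [B]
   beyond [k] bounds each supremum from below. *)
rewrite /limn_esup /limf_esup; apply: le_ereal_inf_tmp => _ [B [m _ mB] <-].
set n := maxn k m; have [H0 Hn] := kH n (leq_maxl k m).
apply: (@le_trans _ _ (u n)); last first.
  by apply: ereal_sup_ubound; exists n => //; apply: mB; exact: leq_maxr.
apply: (@le_trans _ _ ((\sum_(s < n) stop_value R s.+1) /
    \sum_(s < n) (s.+2%:R^-1 : R))%:E).
  by rewrite lee_fin.
apply: le_divee => //.
- have : 0 < 2 - e by case/andP: e01 => _ e1; lra.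
  by move=> /lt_le_trans/(_ Hn); rewrite ltr_pdivlMr// mul0r.
- exact: (expectation_alg_ge hX hindep Ameas n Afeas).
- exact: (expectation_opt_ge0 hX).
- exact: (expectation_opt_le hX hindep).
Qed.
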